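(* In the network model described in the context, let $\mathbb{P}_{\text{out}}^{(A)}$ be the probability of power outage, i.e. the probability that the typical mobile terminal has no available base station. Then $$\mathbb{P}_{\text{out}}^{(A)}=\exp\left(-\Lambda_B^{(A)}\big(p_{\mathsf{L}}^{(\text{cov})}\big)\right),$$ where, for $p\in[0,p_{\mathsf{L}}^{(\text{cov})}]$, $$\Lambda_B^{(A)}(p)=\sum_{l=0}^{l^\star-1}v_l\,\Lambda_B\big(p_l^{(\text{cov})}\big)+\sum_{l=l^\star}^{\mathsf{L}}v_l\,\Lambda_B(p),\qquad \Lambda_B(p)=\lambda_B\Upsilon p^{2/\alpha},$$ and $l^\star=l^\star(p)$ is the integer with $l^\star-1<g_A(p)\le l^\star$.
   Context: All powers are measured in battery power units. Parameters: $\lambda_B,\lambda_{MT},\kappa,\alpha,\mathsf{P_{Rx}},\sigma>0$, $\mu\in\mathbb{R}$, $\mathsf{L}\in\mathbb{N}$, $\mathsf{L}\ge1$. Base stations scBS$_k$ form a homogeneous Poisson point process of intensity $\lambda_B$ in $\mathbb{R}^2$; the typical mobile terminal is at the origin, at distance $r_k$ from scBS$_k$. The shadowing variables $\chi_k$ are i.i.d. log-normal, $10\log_{10}\chi_k\sim\mathcal{N}(\mu,\sigma^2)$, independent of the locations. The transmit power that scBS$_k$ needs to serve the typical terminal is $p_k=\mathsf{P_{Rx}}\,\kappa r_k^\alpha/\chi_k$. The battery state of scBS$_k$ is a random variable in $\{0,1,\dots,\mathsf{L}\}$ with probability vector $\mathbf v=[v_0,\dots,v_{\mathsf{L}}]$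 ($v_l$ is the probability of having $l$ power units); battery states are independent across base stations and independent of locations and shadowing. Let $$\zeta=\tfrac{10}{\ln 10},\qquad \Upsilon=\pi\Big(\tfrac{1}{\mathsf{P_{Rx}}\kappa}\Big)^{2/\alpha}\exp\Big(\tfrac{2/\alpha}{\zeta}\mu+\tfrac12\big(\tfrac{2/\alpha}{\zeta}\big)^2\sigma^2\Big),$$ $$g_A(p)=p+\lambda_{MT}\Upsilon\,\frac{2/\alpha}{2/\alpha+1}\,p^{2/\alpha+1}\quad(p\ge0),\qquad p_l^{(\text{cov})}=g_A^{-1}(l)\quad(0\le l\le\mathsf{L}).$$ Availability criterion: scBS$_k$, with battery state $l$, is available for the typical terminal if and only if $g_A(p_k)\le l$ (equivalently $p_k\le p_l^{(\text{cov})}$). In the paper a power outage is the event that a terminal finds no available base station, or is associated but then dropped for lack of power; under the paper's standing approximation every associated terminal is served, so outage is the event that no base station is available. *)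

(* Defs.v *)
From HB Require Import structures.
From mathcomp Require Import all_boot all_order all_algebra.
From mathcomp Require Import finmap.
From mathcomp Require Import all_classical all_reals all_analysis.
From mathcomp Require Import measurable_realfun.

Set Implicit Arguments.
Unset Strict Implicit.
Unset Printing Implicit Defensive.

Import Order.TTheory GRing.Theory Num.Theory.
Import numFieldNormedType.Exports.

Local Open Scope classical_set_scope.
Local Open Scope ring_scope.

Section Independence.
Context {d : measure_display} {Omega : measurableType d} {R : realType}.
Variable P : probability Omega R.

Definition independent_systems (F G : set (set Omega)) : Prop :=
  forall A B, F A -> G B -> P (A `&` B) = (P A * P B)%E.

Definition mutually_independent {I : choiceType}
    (F : I -> set (set Omega)) : Prop :=
  forall (J : {fset I}) (A : I -> set Omega),
    (forall i, i \in J -> F i (A i)) ->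
    P (\bigcap_(i in [set` J]) A i) = (\prod_(i <- J) P (A i))%E.

Definition sigma_rv {d' : measure_display} {T : measurableType d'}
    (X : Omega -> T) : set (set Omega) :=
  preimage_set_system [set: Omega] X measurable.

Definition sigma_seq {d' : measure_display} {T : measurableType d'}
    (X : nat -> Omega -> T) : set (set Omega) :=
  <<s \bigcup_k sigma_rv (X k) >>.

End Independence.

Section PoissonPointProcess.
Context {d : measure_display} {Omega : measurableType d} {R : realType}.
Variable P : probability Omega R.

Definition plane_measure : set (R * R) -> \bar R :=
  (@lebesgue_measure R \x @lebesgue_measure R)%E.

(* Counts indices, hence points with multiplicity; possibly +oo. *)
Definition point_count (X : nat -> Omega -> R * R) (A : set (R * R))
    (w : Omega) : \bar R :=
  (\sum_(0 <= k <oo) \d_(X k w) A)%E.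

(* A homogeneous Poisson process of intensity lambda > 0 on the plane has
   infinitely many points almost surely, so its points are given as a sequence.
   The second argument of poisson_prob is a dummy; unlike poisson_pmf,
   poisson_prob is also the right law (the Dirac mass at 0) at rate 0. *)
Definition homogeneous_PPP (lambda : R) (X : nat -> Omega -> R * R) : Prop :=
  (forall A, measurable A -> (plane_measure A < +oo)%E ->
     forall n : nat, P [set w | point_count X A w = n%:R%:E] =
       poisson_prob (lambda * fine (plane_measure A)) 0 [set n]) /\
  (forall (m : nat) (A : 'I_m -> set (R * R)),
     (forall i, measurable (A i)) -> trivIset [set: 'I_m] A ->
     mutually_independent P (fun i => sigma_rv (point_count X (A i)))).

End PoissonPointProcess.

(* 10 log10 Y ~ N(mu, sigma^2); normal_prob takes the standard deviation. *)
Definition log_normal_dB {d : measure_display} {Omega : measurableType d}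
    {R : realType} (P : probability Omega R) (mu sigma : R)
    (Y : Omega -> R) : Prop :=
  {ae P, forall w, 0 < Y w} /\
  (forall B : set R, measurable B ->
     P [set w | B (10 * (ln (Y w) / ln 10))] = normal_prob mu sigma B).

Section Network.
Context {R : realType}.
Variables (lambdaB lambdaMT kappa alpha PRx mu sigma : R).

Definition zeta : R := 10 / ln 10.

Definition Upsilon : R :=
  pi * (1 / (PRx * kappa)) `^ (2 / alpha)
     * expR (2 / alpha / zeta * mu
             + 2^-1 * (2 / alpha / zeta) ^+ 2 * sigma ^+ 2).

Definition gA (p : R) : R :=
  p + lambdaMT * Upsilon * (2 / alpha / (2 / alpha + 1)) * p `^ (2 / alpha + 1).

(* The inverse of gA as a bijection of [0, +oo[ onto itself. *)
Definition gA_inv : R -> R := 'pinv_(fun=> 0) [set p : R | 0 <= p] gA.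

Definition pcov (l : nat) : R := gA_inv l%:R.

Definition LambdaB (p : R) : R := lambdaB * Upsilon * p `^ (2 / alpha).

Definition lstar (p : R) : int := Num.ceil (gA p).

Definition LambdaBA (L : nat) (v : 'I_L.+1 -> R) (p : R) : R :=
  \sum_(l < L.+1 | (l%:Z < lstar p)%R) v l * LambdaB (pcov l)
  + \sum_(l < L.+1 | (lstar p <= l%:Z)%R) v l * LambdaB p.

Definition distance0 (x : R * R) : R := Num.sqrt (x.1 ^+ 2 + x.2 ^+ 2).

Definition transmit_power (x : R * R) (chi : R) : R :=
  PRx * kappa * distance0 x `^ alpha / chi.

Definition available (x : R * R) (chi : R) (b : nat) : Prop :=
  gA (transmit_power x chi) <= b%:R.

Definition outage {Omega : Type} (X : nat -> Omega -> R * R)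
    (chi : nat -> Omega -> R) (b : nat -> Omega -> nat) : set Omega :=
  [set w | ~ exists k, available (X k w) (chi k w) (b k w)].

End Network.

(* Main.v *)
Require Import Defs.
From HB Require Import structures.
From mathcomp Require Import all_boot all_order all_algebra.
From mathcomp Require Import finmap.
From mathcomp Require Import all_classical all_reals all_analysis.
From mathcomp Require Import measurable_realfun.
From mathcomp Require Import ring lra.

Import Order.TTheory GRing.Theory Num.Theory.
Import numFieldNormedType.Exports.

Local Open Scope classical_set_scope.
Local Open Scope ring_scope.

(* Given the locations, the base stations are unavailable independently of each
   other, the one at x with probability 1 - q x, where
   q x = sum_l v_l P(PRx kappa |x|^alpha <= p_l chi).  Hence the outage
   probability is E (prod_k (1 - q (X_k))), a Laplace functional of the Poisson
   process, which equals exp (- lambdaB * int q).  By Tonelli, int q is a mixture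
   of expected areas of discs of radius (p_l chi / (PRx kappa))^(1/alpha), and the
   moment of order 2/alpha of the log-normal chi gives
   int q = sum_l v_l Upsilon p_l^(2/alpha). *)

(** * Power consumption *)

(** The points come as a sequence, but only the laws of counts are given: nothing is known about an
    individual [X k], so an expectation over the first [K] points has no closed form. For each [K],
    the probability that none of the first [K] stations is available is therefore computed from
    independence alone and left as an expectation over the locations. The Poisson hypothesis enters
    only in the limit of large [K]: for a simple function in place of q, the product over all points
    depends only on the counts in finitely many disjoint sets, and Poisson generating functions
    evaluate it. Conditioning on the locations is done without conditional expectations:
    independence makes the law of the diagonal map a product measure, and Fubini freezes one factor.
    The shadowing is handled in decibels, where it is Gaussian. Dividing by [zeta] turns decibels
    into natural logarithms, so the log-normal moment of order [2 / alpha] is a Gaussian exponential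
    moment of order [2 / alpha / zeta]; this is the exponential in [Upsilon]. *)

Lemma powR_continuous_within (R : realType) (r l : R) : 0 < r -> 0 < l ->
  {within `[0, l], continuous (fun x => x `^ r)}.
Proof.
move=> r0 l0.
have cts x : 0 < x -> {for x, continuous (fun x => x `^ r)}.
  move=> x0; apply: differentiable_continuous; apply/derivable1_diffP.
  by apply: derivable_powR; rewrite in_itv/= x0.
apply/continuous_within_itvP => //; split.
- by move=> x; rewrite in_itv/= => /andP[x0 _]; exact: cts.
(* Differentiability may fail at 0, so the right limit there is treated separately. *)
- by rewrite powR0 ?gt_eqF//; exact: powR_cvg0.
- by apply: cvg_at_left_filter; exact: cts.
Qed.

Section gA.
Context {R : realType}.
Variables (lambdaMT kappa alpha PRx mu sigma : R).
Hypotheses (lambdaMT_gt0 : 0 < lambdaMT) (kappa_gt0 : 0 < kappa).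
Hypotheses (alpha_gt0 : 0 < alpha) (PRx_gt0 : 0 < PRx).

Local Notation gA := (gA lambdaMT kappa alpha PRx mu sigma).
Local Notation pcov := (pcov lambdaMT kappa alpha PRx mu sigma).

Lemma Upsilon_gt0 : 0 < Upsilon kappa alpha PRx mu sigma.
Proof.
rewrite /Upsilon; apply: mulr_gt0 (expR_gt0 _); apply: mulr_gt0 (pi_gt0 _) _.
by rewrite powR_gt0// divr_gt0// mulr_gt0.
Qed.

Let gA_coef_ge0 : 0 <= lambdaMT * Upsilon kappa alpha PRx mu sigma
                     * (2 / alpha / (2 / alpha + 1)).
Proof.
have a0 : 0 < 2 / alpha by rewrite divr_gt0.
apply: mulr_ge0; first by rewrite mulr_ge0 ?ltW ?Upsilon_gt0.
by rewrite divr_ge0 ?addr_ge0 ?ltW.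
Qed.

Let exponent_gt0 : 0 < 2 / alpha + 1.
Proof. by rewrite addr_gt0 ?divr_gt0. Qed.

Lemma gA0 : gA 0 = 0.
Proof. by rewrite /Defs.gA powR0 ?gt_eqF// mulr0 addr0. Qed.

(** Strictness comes from the linear term; the power term only has to be nondecreasing. *)
Lemma gA_lt x y : 0 <= x -> x < y -> gA x < gA y.
Proof.
move=> x0 xy; apply: ltr_leD => //; apply: ler_wpM2l => //.
have y0 := ltW (le_lt_trans x0 xy).
by apply: ge0_ler_powR; rewrite ?nnegrE// ltW.
Qed.

Lemma gA_le x y : 0 <= x -> 0 <= y -> (gA x <= gA y) = (x <= y).
Proof.
move=> x0 y0; case: (leP x y) => [|yx]; last by apply/negbTE; rewrite -ltNge gA_lt.
by rewrite le_eqVlt => /predU1P[->|xy]; rewrite ?lexx// ltW// gA_lt.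
Qed.

(** The linear term gives [y <= gA y], so [y] lies between the values of [gA] at 0 and at [y], and
    the intermediate value theorem applies. *)
Lemma gA_surj (y : R) : 0 <= y -> exists2 x, 0 <= x & gA x = y.
Proof.
rewrite le_eqVlt => /predU1P[<-|y0]; first by exists 0; rewrite // gA0.
have yg : y <= gA y by rewrite lerDl mulr_ge0 ?powR_ge0.
have cid : {within `[0, y], continuous (fun x : R => x)}.
  by apply: continuous_subspaceT => x; exact: cvg_id.
have cg : {within `[0, y], continuous gA}.
  move=> x; apply: cvgD; first exact: cid.
  by apply: cvgM; [exact: cvg_cst|exact: powR_continuous_within].
have [|x x0 gx] := @IVT _ gA 0 y y (ltW y0) cg.
  by rewrite gA0 /Order.min /Order.max (lt_le_trans y0 yg) (ltW y0) yg.
by exists x => //; rewrite (itvP x0).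
Qed.

Let pcov_spec (l : nat) : 0 <= pcov l /\ gA (pcov l) = l%:R.
Proof.
have surj : set_surj [set p : R | 0 <= p] [set p : R | 0 <= p] gA.
  by move=> y /= y0; have [x x0 <-] := gA_surj y y0; exists x.
have l0 : (0 : R) <= l%:R by [].
split; last by rewrite /Defs.pcov /gA_inv (surjpK _ surj)// inE.
apply: (surjpinv_image_sub surj) => /=; exists l%:R => //.
Qed.

Lemma pcov_ge0 l : 0 <= pcov l. Proof. by have [] := pcov_spec l. Qed.

Lemma gA_pcov l : gA (pcov l) = l%:R. Proof. by have [] := pcov_spec l. Qed.

Lemma gA_le_pcov t l : 0 <= t -> (gA t <= l%:R) = (t <= pcov l).
Proof. by move=> t0; rewrite -gA_pcov gA_le ?pcov_ge0. Qed.

(** Since [gA (pcov L)] is exactly the integer [L], so is its ceiling. The second sum keeps only the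
    index [L], whose term already has the form of the first sum. *)
Lemma LambdaBA_pcov lambdaB (L : nat) (v : 'I_L.+1 -> R) :
  LambdaBA lambdaB lambdaMT kappa alpha PRx mu sigma v (pcov L) =
  \sum_(l < L.+1) v l * LambdaB lambdaB kappa alpha PRx mu sigma (pcov l).
Proof.
rewrite /LambdaBA /lstar gA_pcov.
have -> : Num.ceil (L%:R : R) = L%:Z by rewrite -[L%:R]/(L%:~R) intrKceil.
rewrite [RHS](bigID (fun l : 'I_L.+1 => (l%:Z < L%:Z)%R))/=; congr (_ + _).
apply: eq_big => [l|l]; first by rewrite -leNgt.
rewrite lez_nat => Ll; congr (_ * LambdaB _ _ _ _ _ _ (pcov _)).
by apply/eqP; rewrite eqn_leq Ll -ltnS ltn_ord.
Qed.

End gA.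

(** * Areas of discs *)

Section plane.
Context {R : realType}.
Let plane0 : plane_measure set0 = 0%E :> \bar R.
Proof. exact: measure0. Qed.
Let plane_ge0 (A : set (R * R)) : (0 <= plane_measure A)%E.
Proof. exact: measure_ge0. Qed.
Let plane_sigma_additive : semi_sigma_additive (@plane_measure R).
Proof.
exact: (@measure_semi_sigma_additive _ _ _
  (@lebesgue_measure R \x @lebesgue_measure R)%E).
Qed.
HB.instance Definition _ := isMeasure.Build _ _ _ (@plane_measure R)
  plane0 plane_ge0 plane_sigma_additive.

(** Squares over an increasing exhaustion of the line: a pair with coordinates in [F n] and [F k]
    lies in the square of index [maxn n k]. Tonelli between the plane and the shadowing law relies
    on this. *)
Let plane_sigma_finite : sigma_finite [set: R * R] (@plane_measure R).
Proof.
have /sigma_finiteP[F [TF ndF Foo]] := sigma_finiteT (@lebesgue_measure R).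
exists (fun n => F n `*` F n).
  rewrite -setXTT TF predeqE => -[x y]; split.
    move=> [/= [n _ Fnx] [k _ Gky]]; exists (maxn n k) => //; split.
      by move: x Fnx; exact/subsetPset/ndF/leq_maxl.
    by move: y Gky; exact/subsetPset/ndF/leq_maxr.
  by move=> [n _ []/= ? ?]; split; exists n.
move=> k; have [mF Fk] := Foo k; split; first exact: measurableX.
by rewrite /plane_measure product_measure1E// lte_mul_pinfty// ge0_fin_numE.
Qed.
HB.instance Definition _ := Measure_isSigmaFinite.Build _ _ _ (@plane_measure R)
  plane_sigma_finite.
End plane.

(** Fundamental theorem of calculus with the antiderivative [F]. Its square root and arcsine are not
    differentiable at the ends, so the derivative is computed on the open interval and continuity is
    shown on the closed one. *)
Lemma integral_semicircle (R : realType) (r : R) : 0 < r ->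
  (\int[lebesgue_measure]_(x in `[(- r)%R, r]) (2 * Num.sqrt (r ^+ 2 - x ^+ 2))%R%:E)%E
   = (pi * r ^+ 2)%:E.
Proof.
move=> r0; have rr : - r < r by rewrite gtrN.
have r_neq0 : r != 0 by rewrite gt_eqF.
pose F x := x * Num.sqrt (r ^+ 2 - x ^+ 2) + r ^+ 2 * asin (x / r).
have csq : continuous (fun x : R => Num.sqrt (r ^+ 2 - x ^+ 2)).
  move=> x; apply: (continuous_comp (f := fun x : R => r ^+ 2 - x ^+ 2)).
    by apply: cvgB; [exact: cvg_cst|exact: exprn_continuous].
  exact: sqrt_continuous.
(* Up to the ends, this arcsine is continuous as the inverse of the continuous map [r * sin t] on
   the segment from [- (pi / 2)] to [pi / 2]. *)
have casin : {within `[(- r), r], continuous (fun x : R => asin (x / r))}.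
  have pi0 : - (pi / 2) <= pi / 2 :> R.
    by rewrite lerNl; have := @pi_ge0 R; lra.
  have cs : {within `[(- (pi / 2)), pi / 2], continuous (fun t : R => r * sin t)}.
    apply: continuous_subspaceT => t.
    by apply: cvgM; [exact: cvg_cst|exact: continuous_sin].
  have := segment_can_le_continuous (g := fun x : R => asin (x / r)) pi0 cs.
  rewrite sinN sin_pihalf mulrN mulr1; apply=> t t_in.
  by rewrite mulrAC divff// mul1r sinK.
have cid : {within `[(- r), r], continuous (fun x : R => x)}.
  by apply: continuous_subspaceT => x; exact: cvg_id.
have cF : {within `[(- r), r], continuous F}.
  move=> x; apply: cvgD.
    apply: cvgM; first exact: cid.
    exact: (continuous_subspaceT csq).
  by apply: cvgM; [exact: cvg_cst|exact: casin].
have dF x : x \in `](- r), r[ -> is_derive x 1 F (2 * Num.sqrt (r ^+ 2 - x ^+ 2)).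
  rewrite in_itv/= => /andP[rx xr].
  have d0 : 0 < r ^+ 2 - x ^+ 2.
    by rewrite subr_sqr mulr_gt0 ?subr_gt0// -ltrBlDl sub0r.
  have xr1 : -1 < x / r < 1.
    by rewrite ltr_pdivlMr// mulN1r rx ltr_pdivrMr// mul1r.
  have d1 : is_derive x 1 (fun y : R => Num.sqrt (r ^+ 2 - y ^+ 2))
      (- (x / Num.sqrt (r ^+ 2 - x ^+ 2))).
    have dg : is_derive x 1 (fun y : R => r ^+ 2 - y ^+ 2) (- (2 * x)).
      apply: is_derive_eq.
      by rewrite /GRing.scale/= mulr1; ring.
    have H := @is_derive1_comp R Num.sqrt (fun y : R => r ^+ 2 - y ^+ 2) x _ _
      (is_derive1_sqrt d0) dg.
    apply: (@is_derive_eq _ _ _ _ _ _ _ _ H).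
    have := d0; rewrite -sqrtr_gt0 => /gt_eqF/negbT.
    rewrite /Num.ExtraDef.sqrtr => s0.
    by rewrite invfM; field.
  have d2 : is_derive x 1 (fun y : R => asin (y / r))
      (Num.sqrt (r ^+ 2 - x ^+ 2))^-1.
    have dg : is_derive x 1 (fun y : R => y / r) r^-1.
      by apply: is_derive_eq; rewrite /GRing.scale/= mulr1 ?mulr0 ?addr0 ?add0r.
    have H := @is_derive1_comp R asin (fun y : R => y / r) x _ _
      (is_derive1_asin xr1) dg.
    apply: (@is_derive_eq _ _ _ _ _ _ _ _ H).
    rewrite -invfM; congr (_^-1).
    have -> : r ^+ 2 - x ^+ 2 = r ^+ 2 * (1 - (x / r) ^+ 2) by field.
    by rewrite sqrtrM ?sqr_ge0// sqrtr_sqr gtr0_norm// mulrC.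
  have -> : F = (id * (fun y : R => Num.sqrt (r ^+ 2 - y ^+ 2))
                 + (r ^+ 2) \*: (fun y : R => asin (y / r)))%R by [].
  apply: is_derive_eq.
  rewrite /GRing.scale/=.
  have := d0; rewrite -sqrtr_gt0 => /gt_eqF/negbT.
  set S := Num.ExtraDef.sqrtr _ => S0.
  (* Writing [r ^+ 2] through [S] leaves a rational identity in [S] and [x]. *)
  have -> : r ^+ 2 = S ^+ 2 + x ^+ 2 by rewrite sqr_sqrtr ?ltW// subrK.
  by field.
have [_ Fl Fr] := (continuous_within_itvP _ rr).1 cF.
rewrite (@continuous_FTC2 _ _ F)//; last 3 first.
- by apply: continuous_subspaceT => x; apply: cvgM; [exact: cvg_cst|exact: csq].
- by split=> // x xr; have [] := dF _ xr.
- by move=> x xr; rewrite derive1E; have /@derive_val := dF _ xr.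
rewrite -EFinB /F sqrrN subrr sqrtr0 !mulr0 !add0r mulNr divff//.
rewrite -sin_pihalf -sinN !sinK ?in_itv/=; last 2 first.
- by have := @pi_ge0 R; lra.
- by have := @pi_ge0 R; lra.
by congr _%:E; field.
Qed.

Lemma plane_measure_disc (R : realType) (r : R) : 0 <= r ->
  plane_measure [set x : R * R | x.1 ^+ 2 + x.2 ^+ 2 <= r ^+ 2] = (pi * r ^+ 2)%:E.
Proof.
move=> r0; rewrite /plane_measure /product_measure1.
transitivity (\int[lebesgue_measure]_(x in `[(- r)%R, r])
    (2 * Num.sqrt (r ^+ 2 - x ^+ 2))%R%:E)%E; last first.
  (* The degenerate disc does occur: an empty battery has [pcov 0 = 0]. *)
  move: r0; rewrite le_eqVlt => /predU1P[<-|]; last exact: integral_semicircle.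
  by rewrite oppr0 set_itv1 integral_set1 expr0n mulr0.
rewrite [RHS]integral_mkcond; apply: eq_integral => x _; rewrite patchE.
case: ifPn => [|].
  rewrite inE/= in_itv/= => /andP[rx xr].
  set s := Num.sqrt _.
  have d0 : 0 <= r ^+ 2 - x ^+ 2.
    by rewrite subr_ge0 -ler_sqrt ?sqr_ge0// !sqrtr_sqr (ger0_norm r0) ler_norml rx.
  rewrite (_ : xsection _ _ = `[- s, s]%classic); last first.
    apply/seteqP; split=> y; rewrite /xsection/= inE/= in_itv/= -ler_norml.
      by rewrite -lerBrDl -ler_sqrt// sqrtr_sqr.
    by rewrite -lerBrDl -[y ^+ 2 <= _]ler_sqrt// sqrtr_sqr.
  rewrite lebesgue_measure_itv/= lte_fin.
  have := sqrtr_ge0 (r ^+ 2 - x ^+ 2); rewrite -/s le_eqVlt => /predU1P[<-|s0].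
    by rewrite oppr0 ltxx mulr0.
  by rewrite gtrN// -EFinB opprK mulr_natl.
move=> xr /=; rewrite (_ : xsection _ _ = (set0 : set R)) ?measure0//.
apply/seteqP; split=> y //; rewrite /xsection/= inE/= => xyr.
move/negP: xr; apply; rewrite inE/= in_itv/= -ler_norml -(ger0_norm r0).
rewrite -!sqrtr_sqr ler_sqrt ?sqr_ge0//.
by rewrite (le_trans _ xyr)// lerDl sqr_ge0.
Qed.

(** * Log-normal shadowing *)

(** The Radon-Nikodym derivative of [normal_prob] agrees almost everywhere with [normal_pdf],
    because the two have the same integral over every measurable set. *)
Lemma ge0_integral_normal_prob (R : realType) (m s : R) (f : R -> \bar R) :
  measurable_fun [set: R] f -> (forall x, 0 <= f x)%E ->
  (\int[normal_prob m s]_x f x =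
   \int[lebesgue_measure]_x (f x * (normal_pdf m s x)%:E))%E.
Proof.
move=> mf f0.
rewrite -(Radon_Nikodym_SigmaFinite.change_of_variables (normal_prob_dominates m s))//.
have mpdf := @measurable_normal_pdf R m s.
apply: ae_eq_integral => //.
- apply: emeasurable_funM => //.
  apply: (measurable_int lebesgue_measure).
  exact: Radon_Nikodym_SigmaFinite.f_integrable (normal_prob_dominates m s).
- by apply: emeasurable_funM => //; exact/measurable_EFinP.
apply: ae_eqe_mul2l; apply: integral_ae_eq => //.
- exact: Radon_Nikodym_SigmaFinite.f_integrable (normal_prob_dominates m s).
- exact/measurable_EFinP.
- move=> E _ mE.
  by rewrite -(Radon_Nikodym_SigmaFinite.f_integral (normal_prob_dominates m s)).
Qed.

(** Completing the square: [expR (t * x)] times the density of mean [m] is a constant times the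
    density of mean [m + s ^+ 2 * t], which has total mass 1. *)
Lemma integral_expR_normal_prob (R : realType) (m s t : R) : s != 0 ->
  (\int[normal_prob m s]_x (expR (t * x))%:E)%E =
  (expR (t * m + 2^-1 * t ^+ 2 * s ^+ 2))%:E.
Proof.
move=> s0; rewrite ge0_integral_normal_prob//; last first.
  by apply/measurable_EFinP; apply: measurableT_comp => //; exact: measurable_funM.
set c := expR (t * m + _).
transitivity (\int[lebesgue_measure]_x (c%:E * (normal_pdf (m + s ^+ 2 * t) s x)%:E))%E.
  apply: eq_integral => x _; rewrite -!EFinM; congr _%:E.
  rewrite !normal_pdfE// /normal_fun mulrCA [in RHS]mulrCA; congr (_ * _).
  by rewrite /c -!expRD; congr expR; field.
rewrite ge0_integralZl//= ?integral_normal_pdf ?mule1//.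
- by apply/measurable_EFinP; exact: measurable_normal_pdf.
- by move=> x _; rewrite lee_fin normal_pdf_ge0.
- by rewrite lee_fin expR_ge0.
Qed.

(** * Mean area of the region that a given power covers *)

Section coverage.
Context {R : realType}.
Variables (c alpha z p : R).
Hypotheses (c0 : 0 < c) (alpha0 : 0 < alpha) (p0 : 0 <= p).

Lemma measurable_distance0 : measurable_fun [set: R * R] (@distance0 R).
Proof.
apply: measurableT_comp; first exact: (continuous_measurable_fun (@sqrt_continuous R)).
by apply: measurable_funD; apply: measurable_funX.
Qed.

(** The second coordinate is the shadowing in decibels; for [z] equal to [zeta], [expR (xn.2 / z)]
    is the shadowing itself. The bound by [p] on the required power is cleared of its positive
    denominator. *)
Definition covered : set ((R * R) * R) :=
  [set xn | c * distance0 xn.1 `^ alpha <= p * expR (xn.2 / z)].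

Lemma measurable_covered : measurable covered.
Proof.
rewrite -[X in measurable X]setTI; apply: measurable_fun_le => //.
  apply: measurable_funM => //.
  apply: (measurableT_comp (measurable_powR alpha)).
  exact: (measurableT_comp measurable_distance0).
apply: measurable_funM => //; apply: measurableT_comp => //.
exact: measurable_funM.
Qed.

Lemma ysection_covered n :
  ysection covered n =
  [set x | x.1 ^+ 2 + x.2 ^+ 2 <= ((p * expR (n / z) / c) `^ alpha^-1) ^+ 2].
Proof.
have y0 : 0 <= p * expR (n / z) / c.
  by rewrite divr_ge0 ?mulr_ge0 ?expR_ge0//; exact: ltW.
have ai0 : 0 < alpha^-1 by rewrite invr_gt0.
have alphaK t : 0 <= t -> (t `^ alpha) `^ alpha^-1 = t.
  by move=> t0; rewrite -powRrM divff ?gt_eqF// powRr1.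
have alphaVK t : 0 <= t -> (t `^ alpha^-1) `^ alpha = t.
  by move=> t0; rewrite -powRrM mulVf ?gt_eqF// powRr1.
apply/funext => x; apply/propext; rewrite /ysection/= inE /covered/=.
have d0 : 0 <= distance0 x by exact: sqrtr_ge0.
have -> : x.1 ^+ 2 + x.2 ^+ 2 = distance0 x ^+ 2.
  by rewrite /distance0 sqr_sqrtr// addr_ge0 ?sqr_ge0.
rewrite ler_sqr ?nnegrE ?powR_ge0// mulrC -ler_pdivlMr//.
split=> h.
  rewrite -[distance0 x]alphaK//.
  by apply: ge0_ler_powR; rewrite ?nnegrE ?powR_ge0//; exact: ltW.
rewrite -[X in _ <= X]alphaVK//.
by apply: ge0_ler_powR; rewrite ?nnegrE ?powR_ge0//; exact: ltW.
Qed.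

Lemma integral_covered m s : s != 0 ->
  (\int[@plane_measure R]_x normal_prob m s (xsection covered x))%E =
  (pi * (p / c) `^ (2 / alpha)
     * expR (2 / alpha / z * m + 2^-1 * (2 / alpha / z) ^+ 2 * s ^+ 2))%:E.
Proof.
move=> s0.
have := indic_fubini_tonelli (@plane_measure R) (normal_prob m s) measurable_covered.
rewrite indic_fubini_tonelli_FE ?indic_fubini_tonelli_GE//=;
  try exact: measurable_covered.
move=> ->.
(* The squared radius splits into a deterministic factor and an exponential of rate [2 / alpha / z]
   in the shadowing [n]. *)
transitivity (\int[normal_prob m s]_n
    ((pi * (p / c) `^ (2 / alpha))%:E * (expR (2 / alpha / z * n))%:E))%E.
  apply: eq_integral => n _ /=.
  rewrite ysection_covered plane_measure_disc ?powR_ge0// -EFinM; congr _%:E.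
  rewrite -[RHS]mulrA; congr (_ * _).
  rewrite -powR_mulrn ?powR_ge0// -powRrM (mulrAC p) [alpha^-1 * _]mulrC.
  have pc0 : 0 <= p / c by rewrite divr_ge0// ltW.
  rewrite [LHS]powRM ?expR_ge0//; congr (_ * _).
  rewrite /powR (gt_eqF (expR_gt0 _)) expRK; congr expR.
  by rewrite mulrA mulrAC.
rewrite ge0_integralZl//=.
- by rewrite integral_expR_normal_prob// -EFinM.
- apply/measurable_EFinP; apply: measurableT_comp => //.
- by rewrite lee_fin mulr_ge0 ?pi_ge0 ?powR_ge0.
Qed.
End coverage.

(** * Independence *)

Section finite_products.
Context {d : measure_display} {Omega : measurableType d} {R : realType}.
Variable P : probability Omega R.

Lemma measurable_forall_fin (J : finType) (E : J -> set Omega) :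
  (forall j, measurable (E j)) -> measurable [set w | forall j, E j w].
Proof.
move=> mE; rewrite (_ : [set w | _] = \bigcap_(j in [set: J]) E j).
  by apply: fin_bigcap_measurable => //; exact: finite_finset.
by apply/seteqP; split=> [w Ew j _|w Ew j]; exact: Ew.
Qed.

Lemma prod_indic (J : finType) (E : J -> set Omega) w :
  \prod_j \1_(E j) w = \1_[set w | forall j, E j w] w :> R.
Proof.
rewrite [RHS]indicE; have [|] := boolP (w \in _).
  rewrite inE/= => Ew; rewrite big1// => j _.
  by rewrite indicE mem_set.
rewrite notin_setE/= => /existsNP[j Ej].
by rewrite (bigD1 j)//= indicE memNset// mul0r.
Qed.

(** Distributing the product over the sums leaves probabilities of finite intersections, to which
    independence applies. It serves both the battery states and the point counts. *)
Lemma integral_prod_sum_indic (J L : finType) (a : J -> L -> R)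
    (E : J -> L -> set Omega) :
  (forall j l, 0 <= a j l) -> (forall j l, measurable (E j l)) ->
  (\int[P]_w (\prod_j \sum_l a j l * \1_(E j l) w)%:E =
   \sum_(f : {ffun J -> L})
     (\prod_j a j (f j))%:E * P [set w | forall j, E j (f j) w])%E.
Proof.
move=> a0 mE.
have mEf (f : {ffun J -> L}) : measurable [set w | forall j, E j (f j) w].
  exact: measurable_forall_fin.
have pa0 (f : {ffun J -> L}) : 0 <= \prod_j a j (f j) by apply: prodr_ge0.
transitivity (\int[P]_w (\sum_(f : {ffun J -> L}) (\prod_j a j (f j))%:E *
    (\1_[set w | forall j, E j (f j) w] w)%:E))%E.
  apply: eq_integral => w _; rewrite bigA_distr_bigA/= -sumEFin.
  apply: eq_bigr => f _; rewrite -EFinM; congr _%:E.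
  by rewrite big_split/= prod_indic.
rewrite ge0_integral_sum//; last 2 first.
- by move=> f; apply: emeasurable_funM => //; apply/measurable_EFinP.
- by move=> f w _; rewrite mule_ge0// lee_fin.
apply: eq_bigr => f _; rewrite ge0_integralZl//=.
- by rewrite integral_indic// setIT.
- by apply/measurable_EFinP.
- by rewrite lee_fin.
Qed.

Lemma mutually_independent_forall (I : choiceType) (F : I -> set (set Omega))
    (s : seq I) (A : I -> set Omega) :
  mutually_independent P F -> uniq s -> (forall i, i \in s -> F i (A i)) ->
  P [set w | forall i, i \in s -> A i w] = (\prod_(i <- s) P (A i))%E.
Proof.
move=> indepF us FA.
have := indepF [fset i | i in s]%fset A.
rewrite (_ : \bigcap_(i in _) A i = [set w | forall i, i \in s -> A i w]); last first.
  apply/seteqP; split=> w Aw i; last by rewrite /= inE/= => /Aw.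
  by move=> si; apply: Aw; rewrite /= inE.
move=> -> ; last by move=> i; rewrite inE/= => /FA.
apply/perm_big/uniq_perm => // i.
by rewrite inE.
Qed.

Lemma mutually_independent_ord (F : nat -> set (set Omega)) K (A : 'I_K -> set Omega) :
  mutually_independent P F -> (forall k : 'I_K, F k (A k)) ->
  P [set w | forall k, A k w] = (\prod_(k < K) P (A k))%E.
Proof.
move=> indepF FA.
pose A' (n : nat) := if insub n is Some k then A k else setT.
have A'E (k : 'I_K) : A' k = A k by rewrite /A' valK.
have := @mutually_independent_forall _ F (iota 0 K) A' indepF (iota_uniq _ _).
rewrite (_ : [set w | _] = [set w | forall k, A k w]); last first.
  apply/seteqP; split=> w Aw k.
    by rewrite -A'E; apply: Aw; rewrite mem_iota/=.
  by rewrite mem_iota/= => kK; rewrite (A'E (Ordinal kK)).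
move=> ->; last first.
  move=> k; rewrite mem_iota/= => kK; rewrite (A'E (Ordinal kK)).
  exact: FA (Ordinal kK).
rewrite -[K in iota 0 K]subn0 -/(index_iota 0 K) big_mkord.
by apply: eq_bigr => k _; rewrite A'E.
Qed.

End finite_products.

Section independence_fubini.
Context {d : measure_display} {Omega : measurableType d} {R : realType}.
Variable P : probability Omega R.
Variables G H : set (set Omega).
Hypotheses (mG : G `<=` measurable) (mH : H `<=` measurable).
Hypothesis indep : independent_systems P <<s G>> <<s H>>.

(** Copies of [Omega] that carry only the events generated by [G] or by [H]: the measurable
    rectangles of [OG * OH] are then made of the pairs of events about which [indep] speaks. *)
Let OG : measurableType _ := g_sigma_algebraType G.
Let OH : measurableType _ := g_sigma_algebraType H.

Let idG : Omega -> OG := id.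
Let idH : Omega -> OH := id.

Let midG : measurable_fun setT idG.
Proof.
move=> _ B mB; rewrite setTI; move: B mB.
by apply: smallest_sub => //; exact: sigma_algebra_measurable.
Qed.
Let midH : measurable_fun setT idH.
Proof.
move=> _ B mB; rewrite setTI; move: B mB.
by apply: smallest_sub => //; exact: sigma_algebra_measurable.
Qed.
HB.instance Definition _ := isMeasurableFun.Build _ _ _ _ idG midG.
HB.instance Definition _ := isMeasurableFun.Build _ _ _ _ idH midH.
Let diag : Omega -> OG * OH := fun w => (w, w).
Let mdiag : measurable_fun setT diag.
Proof. exact: measurable_fun_pair. Qed.
HB.instance Definition _ := isMeasurableFun.Build _ _ _ _ diag mdiag.

(* The law of the diagonal map Omega -> OG * OH is a product measure, by
   independence. *)
Lemma independent_fubini (S : set (OG * OH)) : measurable S ->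
  P [set w | S (w, w)] = (\int[P]_w P (xsection S w))%E.
Proof.
move=> mS.
have rect (A : set OG) (B : set OH) : measurable A -> measurable B ->
    distribution P diag (A `*` B) = (distribution P idG A * distribution P idH B)%E.
  by move=> mA mB; exact: indep.
transitivity (distribution P diag S); first by [].
rewrite -(product_measure_unique rect mS) /= /product_measure1.
rewrite ge0_integral_distribution//.
exact: measurable_fun_xsection.
Qed.

End independence_fubini.

Lemma bigcup_sigma_rv_measurable (d d' : measure_display)
    (Omega : measurableType d) (T : measurableType d') (R : realType)
    (P : probability Omega R) (X : nat -> {RV P >-> T}) :
  \bigcup_k sigma_rv (X k) `<=` measurable.
Proof. by move=> _ [k _ [B mB <-]]; exact: measurable_funPT. Qed.

Section marked_points.
Context {d d1 d2 : measure_display} {Omega : measurableType d} {R : realType}.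
Context {T1 : measurableType d1} {T2 : measurableType d2}.
Variable P : probability Omega R.
Variables (X : nat -> {RV P >-> T1}) (Y : nat -> {RV P >-> T2}).
Hypothesis indepXY : independent_systems P (sigma_seq X) (sigma_seq Y).
Hypothesis indepY : mutually_independent P (fun k => sigma_rv (Y k)).

(** This stands in for conditioning on the points: [independent_fubini] freezes the outcome seen by
    [X], the event then concerns the marks only, and their mutual independence factorizes it. *)
Lemma independent_marks K (B : 'I_K -> set (T1 * T2)) :
  (forall k, measurable (B k)) ->
  P [set w | forall k : 'I_K, B k (X k w, Y k w)] =
  (\int[P]_w (\prod_(k < K) P (Y k @^-1` xsection (B k) (X k w))))%E.
Proof.
move=> mB.
pose G := \bigcup_k sigma_rv (X k); pose H := \bigcup_k sigma_rv (Y k).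
pose OG := g_sigma_algebraType G; pose OH := g_sigma_algebraType H.
have mX k : measurable_fun [set: OG] (X k : OG -> T1).
  move=> _ A mA; rewrite setTI; apply: sub_sigma_algebra; exists k => //.
  by exists A => //; rewrite setTI.
have mY k : measurable_fun [set: OH] (Y k : OH -> T2).
  move=> _ A mA; rewrite setTI; apply: sub_sigma_algebra; exists k => //.
  by exists A => //; rewrite setTI.
pose S := [set ww : OG * OH | forall k : 'I_K, B k (X k ww.1, Y k ww.2)].
have mS : measurable S.
  apply: (@measurable_forall_fin _ _ _
    (fun (k : 'I_K) => [set ww : OG * OH | B k (X k ww.1, Y k ww.2)])).
  move=> k.
  have mXY : measurable_fun [set: OG * OH] (fun ww : OG * OH => (X k ww.1, Y k ww.2)).
    apply: measurable_fun_pair; first exact: (measurableT_comp (mX k) measurable_fst).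
    exact: (measurableT_comp (mY k) measurable_snd).
  by have := mXY measurableT (B k) (mB k); rewrite setTI.
have := @independent_fubini _ _ _ P G H (@bigcup_sigma_rv_measurable _ _ _ _ _ P X)
  (@bigcup_sigma_rv_measurable _ _ _ _ _ P Y) indepXY S mS.
rewrite /S/= => ->.
apply: eq_integral => w _.
rewrite -(@mutually_independent_ord _ _ _ P (fun k => sigma_rv (Y k)) K
  (fun k => Y k @^-1` xsection (B k) (X k w)) indepY).
  congr (P _); apply/seteqP; split=> w'; rewrite /xsection/= ?inE/= => h k.
    by have := h k; rewrite inE.
  by have := h k; rewrite inE.
move=> k; exists (xsection (B k) (X k w)); rewrite ?setTI//.
exact: measurable_xsection.
Qed.
End marked_points.

Section independent_mixtures.
Context {d d1 d2 : measure_display} {Omega : measurableType d} {R : realType}.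
Context {T1 : measurableType d1} {T2 : measurableType d2}.
Variable P : probability Omega R.
Variables (X : nat -> {RV P >-> T1}) (Y : nat -> {RV P >-> T2}).
Variables (L : nat) (v : 'I_L.+1 -> R) (b : nat -> {RV P >-> nat}).
Hypothesis indepXY : independent_systems P (sigma_seq X) (sigma_seq Y).
Hypothesis indepY : mutually_independent P (fun k => sigma_rv (Y k)).
Hypothesis b_le : forall k w, (b k w <= L)%N.
Hypothesis b_law : forall k (l : 'I_L.+1), P [set w | b k w = l] = (v l)%:E.
Hypothesis indepb : mutually_independent P (fun k => sigma_rv (b k)).
Hypothesis indepbXY : independent_systems P (sigma_seq b)
                       <<s sigma_seq X `|` sigma_seq Y >>.
Variables (C : nat -> set (T1 * T2)) (Q : nat -> T1 -> R).
Hypothesis mC : forall l, measurable (C l).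
Hypothesis mQ : forall l, measurable_fun [set: T1] (Q l).
Hypothesis QE : forall k l x, P (Y k @^-1` xsection (C l) x) = (Q l x)%:E.

Let v_ge0 l : 0 <= v l.
Proof. by rewrite -lee_fin -(b_law 0%N). Qed.

Let Q_ge0 l x : 0 <= Q l x.
Proof. by rewrite -lee_fin -(QE 0%N). Qed.

Let mb k l : sigma_rv (b k) [set w | b k w = l].
Proof. by exists [set l] => //; rewrite setTI. Qed.

Let mCXY k l : <<s sigma_seq X `|` sigma_seq Y >> [set w | C l (X k w, Y k w)].
Proof.
pose O := g_sigma_algebraType (sigma_seq X `|` sigma_seq Y).
have mX : measurable_fun [set: O] (X k : O -> T1).
  move=> _ A mA; rewrite setTI; apply: sub_sigma_algebra; left.
  by apply: sub_sigma_algebra; exists k => //; exists A => //; rewrite setTI.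
have mY : measurable_fun [set: O] (Y k : O -> T2).
  move=> _ A mA; rewrite setTI; apply: sub_sigma_algebra; right.
  by apply: sub_sigma_algebra; exists k => //; exists A => //; rewrite setTI.
have mXY : measurable_fun [set: O] (fun w : O => (X k w, Y k w)).
  exact: measurable_fun_pair.
by have := mXY measurableT (C l) (mC l); rewrite setTI.
Qed.

Let mCXYk k l : measurable [set w | C l (X k w, Y k w)].
Proof.
have mXY : measurable_fun [set: Omega] (fun w => (X k w, Y k w)).
  exact: measurable_fun_pair.
by have := mXY measurableT (C l) (mC l); rewrite setTI.
Qed.

Let E k l := [set w | b k w = l] `&` [set w | C l (X k w, Y k w)].

Let mE k l : measurable (E k l).
Proof.
apply: measurableI => //.
by have [B mB <-] := mb k l; exact: measurable_funPT.
Qed.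

(** The event is split according to the vector [f] of battery states of the first [K] stations. For
    fixed [f], the batteries separate from locations and marks, and [independent_marks] applies;
    distributivity, read backwards, then folds the sum over [f] into a product of mixtures. *)
Lemma independent_mixture K :
  P [set w | forall k : 'I_K, C (b k w) (X k w, Y k w)] =
  (\int[P]_w (\prod_(k < K) \sum_(l < L.+1) v l * Q l (X k w))%:E)%E.
Proof.
have mO : measurable [set w | forall k : 'I_K, C (b k w) (X k w, Y k w)].
  apply: measurable_forall_fin => k.
  have -> : (fun w => C (b k w) (X k w, Y k w)) = \bigcup_l E k l;
    last exact: bigcupT_measurable.
  by apply/seteqP; split=> [w Cw|w [l _ [/= <-]]//]; exists (b k w).
(* Only the actual battery state [b k w] contributes to the inner sum; it is a valid index because
   it is at most [L]. *)
transitivity (\int[P]_w (\prod_(k < K) \sum_(l < L.+1) 1 * \1_(E k l) w)%:E)%E.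
  rewrite -[X in P X]setIT -integral_indic//.
  apply: eq_integral => w _; congr _%:E; rewrite -prod_indic.
  apply: eq_bigr => k _.
  have bL : (b k w < L.+1)%N by rewrite ltnS.
  rewrite (bigD1 (Ordinal bL))//= mul1r big1 ?addr0.
    rewrite !indicE; congr ((nat_of_bool _)%:R); apply/idP/idP; rewrite !inE => //.
    by case.
  move=> l; rewrite -val_eqE/= => lb.
  by rewrite indicE memNset ?mulr0//= => -[/= bl _]; rewrite bl eqxx in lb.
rewrite (@integral_prod_sum_indic _ _ _ P 'I_K 'I_L.+1 (fun _ _ => 1)
  (fun k l => E k l))//.
transitivity (\sum_(f : {ffun 'I_K -> 'I_L.+1})
    \int[P]_w ((\prod_k v (f k)) * \prod_(k < K) Q (f k) (X k w))%:E)%E.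
  apply: eq_bigr => f _; rewrite big1// mul1e.
  rewrite (_ : [set w | _] = [set w | forall k : 'I_K, b k w = f k] `&`
      [set w | forall k : 'I_K, C (f k) (X k w, Y k w)]); last first.
    apply/seteqP; split=> [w Ew|w [bw Cw] k]; last by split.
    by split=> k; have [] := Ew k.
  rewrite indepbXY; last 2 first.
  - apply: (@measurable_forall_fin _ (g_sigma_algebraType (\bigcup_k sigma_rv (b k))) 'I_K
      (fun k => [set w | b k w = f k])) => k.
    by apply: sub_sigma_algebra; exists k.
  - by apply: (@measurable_forall_fin _
      (g_sigma_algebraType (sigma_seq X `|` sigma_seq Y)) 'I_K
      (fun k => [set w | C (f k) (X k w, Y k w)])) => k; exact: mCXY.
  have := @mutually_independent_ord _ _ _ P (fun k => sigma_rv (b k)) K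
    (fun k => [set w | b k w = f k]) indepb (fun k => mb k (f k)).
  move=> ->.
  rewrite (@independent_marks _ _ _ _ _ _ _ P X Y indepXY indepY K (fun k => C (f k)))//.
  rewrite (eq_bigr (fun k => (v (f k))%:E)) ?prodEFin; last by move=> k _; exact: b_law.
  rewrite (eq_integral (fun w => (\prod_(k < K) Q (f k) (X k w))%:E)); last first.
    move=> w _; rewrite -prodEFin; apply: eq_bigr => k _; exact: QE.
  rewrite -ge0_integralZl//=.
  - apply/measurable_EFinP; apply: measurable_prod => k _.
    exact: measurableT_comp.
  - by move=> w _; rewrite lee_fin prodr_ge0.
  - by rewrite lee_fin prodr_ge0.
rewrite -ge0_integral_sum//.
- apply: eq_integral => w _; rewrite sumEFin bigA_distr_bigA/=; congr _%:E.
  by apply: eq_bigr => f _; rewrite big_split.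
- move=> f; apply/measurable_EFinP; apply: measurable_funM => //.
  by apply: measurable_prod => k _; exact: measurableT_comp.
- by move=> f w _; rewrite lee_fin mulr_ge0// prodr_ge0.
Qed.

End independent_mixtures.

(** * Laplace functional of a Poisson process *)

Lemma cvg_prodr (R : realType) (I : Type) (s : seq I) (f : I -> nat -> R) (l : I -> R) :
  (forall i, f i n @[n --> \oo] --> l i) ->
  \prod_(i <- s) f i n @[n --> \oo] --> \prod_(i <- s) l i.
Proof.
move=> fl; elim: s => [|i s ih].
  by rewrite big_nil; under eq_fun do rewrite big_nil; exact: cvg_cst.
by rewrite big_cons; under eq_fun do rewrite big_cons; exact: cvgM.
Qed.

Section bounded_convergence.
Context {d : measure_display} {Omega : measurableType d} {R : realType}.
Variable P : probability Omega R.

Lemma bounded_convergence (f : nat -> Omega -> R) (g : Omega -> R) :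
  (forall n, measurable_fun [set: Omega] (f n)) ->
  measurable_fun [set: Omega] g ->
  (forall n w, 0 <= f n w <= 1) ->
  {ae P, forall w, f n w @[n --> \oo] --> g w} ->
  (\int[P]_w (f n w)%:E)%E @[n --> \oo] --> (\int[P]_w (g w)%:E)%E.
Proof.
move=> mf mg f01 fg.
have [] := @dominated_convergence _ _ _ P setT measurableT
  (fun n w => (f n w)%:E) (fun w => (g w)%:E) (cst 1%E) => //.
- by move=> n; exact/measurable_EFinP.
- exact/measurable_EFinP.
- apply: filterS fg => w fgw _; apply/fine_cvgP; split => //.
  exact: nearW.
- by apply: (@finite_measure_integrable_cst _ _ _ P setT 1).
- apply: aeW => w n _; rewrite lee_fin.
  by have /andP[f0 f1] := f01 n w; rewrite ger0_norm.
Qed.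

End bounded_convergence.

Section poisson.
Context {R : realType}.

Lemma poisson_prob_set1 (r : R) (k n : nat) : 0 <= r ->
  poisson_prob r k [set n] = (r ^+ n / n`!%:R * expR (- r))%:E.
Proof.
rewrite le_eqVlt => /predU1P[<-|r0]; rewrite /poisson_prob.
  (* Rate 0, the case of a null set: the Dirac mass at 0 fits the formula because [0 ^+ 0] is 1. *)
  rewrite ltxx diracE oppr0 expR0 mulr1 expr0n.
  case: n => [|n]; first by rewrite mem_set//= divr1.
  by rewrite memNset ?mul0r// => /=.
rewrite r0 esum_set1; last by rewrite lee_fin poisson_pmf_ge0.
by rewrite /poisson_pmf r0.
Qed.

Lemma poisson_generating_function (r u : R) (k : nat) : 0 <= r ->
  \sum_(j < n.+1) u ^+ j * fine (poisson_prob r k [set nat_of_ord j])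
    @[n --> \oo] --> expR (- (r * (1 - u))).
Proof.
move=> r0.
rewrite (_ : expR _ = expR (- r) * expR (u * r)); last first.
  by rewrite -expRD; congr expR; ring.
have := @is_cvg_series_exp_coeff R (u * r).
(* The sum includes the index [n], so it matches the exponential series at [n.+1]. *)
rewrite -cvg_shiftS => h.
rewrite (_ : (fun n => _) = (fun n => expR (- r) * series (exp_coeff (u * r)) n.+1)).
  by apply: cvgM; [exact: cvg_cst|].
apply/funext => n; rewrite /series/= mulr_sumr big_mkord; apply: eq_bigr => j _.
by rewrite poisson_prob_set1//= /exp_coeff/= exprMn; ring.
Qed.

End poisson.

Section counts.
Context {d : measure_display} {Omega : measurableType d} {R : realType}.
Variables (P : probability Omega R) (X : nat -> {RV P >-> (R * R)%type}).

Lemma measurable_point_count (A : set (R * R)) : measurable A ->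
  measurable_fun [set: Omega] (point_count X A).
Proof.
move=> mA.
apply: (@ge0_emeasurable_sum _ _ _ _ (fun k w => \d_(X k w) A) xpredT) => // k _.
under eq_fun do rewrite diracE.
apply/measurable_EFinP.
rewrite (_ : (fun _ => _) = \1_A \o X k)//.
by apply: measurableT_comp => //; exact: measurable_indic.
Qed.

(** Partial counts are natural numbers, so once they are within distance 1 of their limit they equal
    it. *)
Lemma point_count_eventually (A : set (R * R)) w n :
  point_count X A w = n%:R%:E ->
  \forall K \near \oo, (\sum_(k < K) (X k w \in A : nat))%N = n.
Proof.
move=> XAn.
have : (\sum_(0 <= k < K) \d_(X k w) A)%E @[K --> \oo] --> (n%:R%:E : \bar R).
  rewrite -XAn; apply: is_cvg_nneseries => k _ _; exact: measure_ge0.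
rewrite (_ : (fun K => _) =
    (fun K => ((\sum_(k < K) (X k w \in A : nat))%N%:R : R)%:E)); last first.
  apply/funext => K; rewrite big_mkord natr_sum -sumEFin.
  by apply: eq_bigr => k _; rewrite diracE.
move=> /fine_cvgP[_] /cvgrPdist_lt /(_ 1 ltr01).
apply: filterS => K /=.
set m := (\sum_(k < K) _)%N.
case: (ltngtP m n) => // mn; last rewrite distrC.
  by rewrite -natrB ?(ltnW mn)// normr_nat ltrn1 ltnS leqn0 subn_eq0 leqNgt mn.
by rewrite -natrB ?(ltnW mn)// normr_nat ltrn1 ltnS leqn0 subn_eq0 leqNgt mn.
Qed.
End counts.

(** * Laplace functional on simple functions *)

Section laplace_simple.
Context {d : measure_display} {Omega : measurableType d} {R : realType}.
Variables (P : probability Omega R) (X : nat -> {RV P >-> (R * R)%type}).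
Variable lambda : R.
Hypothesis lambda_ge0 : 0 <= lambda.
Hypothesis X_PPP : homogeneous_PPP P lambda X.
Variables (m : nat) (A : 'I_m -> set (R * R)) (c : 'I_m -> R).
Hypothesis mA : forall i, measurable (A i).
Hypothesis A_fin : forall i, (plane_measure (A i) < +oo)%E.
Hypothesis A_disj : trivIset [set: 'I_m] A.
Hypothesis c01 : forall i, 0 <= c i <= 1.

Let u i := 1 - c i.
Let rho i := lambda * fine (plane_measure (A i)).
Let N i := point_count X (A i).
Let s x := \sum_i c i * \1_(A i) x.

Let u01 i : 0 <= u i <= 1.
Proof. by have /andP[c0 c1] := c01 i; rewrite /u subr_ge0 c1 lerBlDl lerDr. Qed.

Let rho_ge0 i : 0 <= rho i.
Proof. by rewrite mulr_ge0// fine_ge0. Qed.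

Let N_law i n : P [set w | N i w = n%:R%:E] = poisson_prob (rho i) 0 [set n].
Proof. exact: X_PPP.1. Qed.

Let mN i n : sigma_rv (N i) [set w | N i w = n%:R%:E].
Proof. by exists [set n%:R%:E] => //; rewrite setTI. Qed.

Let mNn i n : measurable [set w | N i w = n%:R%:E].
Proof.
have [B mB <-] := mN i n.
exact: (@measurable_point_count _ _ _ P X _ (mA i)).
Qed.

(** By disjointness at most one [A i] contains [x], so at most one factor differs from 1. *)
Let sE x : 1 - s x = \prod_i u i ^+ (x \in A i).
Proof.
have [[i Ai]|/forallNP nA] := pselect (exists i, A i x).
  have nj j : j != i -> x \notin A j.
    move=> ji; apply/negP; rewrite inE => Aj.
    by move: ji; rewrite (A_disj j i I I (ex_intro _ x (conj Aj Ai))) eqxx.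
  rewrite /s (bigD1 i)//= [RHS](bigD1 i)//= indicE mem_set// mulr1 !big1 ?addr0 ?mulr1//.
    by move=> j /nj /negbTE ->.
  by move=> j /nj; rewrite indicE => /negbTE ->; rewrite mulr0.
rewrite /s !big1 ?subr0// => i _; first by rewrite memNset.
by rewrite indicE memNset ?mulr0.
Qed.

Let W (K : nat) w := \prod_(k < K) (1 - s (X k w)).

(** Grouping the points by cell shows that [W] depends on them only through the counts, whose joint
    law is known in the limit. *)
Let WE K w : W K w = \prod_i u i ^+ (\sum_(k < K) (X k w \in A i))%N.
Proof.
rewrite /W (eq_bigr (fun k : 'I_K => \prod_i u i ^+ (X k w \in A i))) => [|k _];
  last exact: sE.
rewrite exchange_big/=; apply: eq_bigr => i _.
by rewrite prodrXr.
Qed.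

Let s01 x : 0 <= 1 - s x <= 1.
Proof.
rewrite sE prodr_ge0 ?prodr_ile1// => i _.
  by have /andP[? ?] := u01 i; rewrite exprn_ge0//= exprn_ile1.
by have /andP[? ?] := u01 i; exact: exprn_ge0.
Qed.

Let W01 K w : 0 <= W K w <= 1.
Proof. by rewrite /W prodr_ge0 ?prodr_ile1// => k _; have /andP[] := s01 (X k w). Qed.

Let ms : measurable_fun [set: R * R] s.
Proof.
apply: measurable_sum => i; apply: measurable_funM => //; exact: measurable_indic.
Qed.

Let mW K : measurable_fun [set: Omega] (W K).
Proof.
apply: measurable_prod => k _; apply: measurable_funB => //.
exact: measurableT_comp.
Qed.

Let W_cvg w : cvgn (W ^~ w).
Proof.
apply: nonincreasing_is_cvgn.
  apply/nonincreasing_seqP => K; rewrite /W big_ord_recr/=.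
  have /andP[W0 _] := W01 K w; have /andP[_ s1] := s01 (X K w).
  exact: ler_piMr.
by exists 0 => _ [K _ <-]; have /andP[] := W01 K w.
Qed.

Let V w := limn (W ^~ w).

Let mV : measurable_fun [set: Omega] V.
Proof. by apply: measurable_fun_cvg mW _ => w _; exact: W_cvg. Qed.

(* Equal to \prod_i u i ^+ N i w as soon as n bounds all the counts N i w. *)
Let U n w :=
  \prod_i \sum_(j < n.+1) u i ^+ j * \1_[set w | N i w = (nat_of_ord j)%:R%:E] w.

Let U_fin n i w (q : nat) : N i w = q%:R%:E -> (q <= n)%N ->
  \sum_(j < n.+1) u i ^+ j * \1_[set w | N i w = (nat_of_ord j)%:R%:E] w = u i ^+ q.
Proof.
move=> Nq qn; have qn1 : (q < n.+1)%N by rewrite ltnS.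
rewrite (bigD1 (Ordinal qn1))//= indicE mem_set// mulr1 big1 ?addr0// => j.
rewrite -val_eqE/= => jq; rewrite indicE memNset ?mulr0//= Nq => -[] /eqP.
by rewrite eqr_nat eq_sym (negbTE jq).
Qed.

Let U_sum01 n i w :
  0 <= \sum_(j < n.+1) u i ^+ j * \1_[set w | N i w = (nat_of_ord j)%:R%:E] w <= 1.
Proof.
have /andP[u0 u1] := u01 i.
rewrite sumr_ge0 => [/=|j _]; last by rewrite mulr_ge0 ?exprn_ge0.
have [[q Nq]|/forallNP nN] := pselect (exists q : 'I_n.+1, N i w = q%:R%:E).
  by rewrite (U_fin _ _ _ _ Nq) ?exprn_ile1// -ltnS.
by rewrite big1// => j _; rewrite indicE memNset ?mulr0//; exact: nN.
Qed.

Let U01 n w : 0 <= U n w <= 1.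
Proof. by rewrite /U prodr_ge0 ?prodr_ile1// => i _; have /andP[] := U_sum01 n i w. Qed.

Let mU n : measurable_fun [set: Omega] (U n).
Proof.
apply: measurable_prod => i _; apply: measurable_sum => j.
by apply: measurable_funM => //; exact: measurable_indic.
Qed.

(** A count may be [+oo] on some outcomes, but its Poisson law already gives total mass 1 to the
    natural numbers. *)
Let N_fin : {ae P, forall w i, exists n, N i w = n%:R%:E}.
Proof.
apply: filter_forall => i.
have trivN : trivIset setT (fun n => [set w | N i w = n%:R%:E]).
  by move=> j k _ _ [w [/= -> []] /eqP]; rewrite eqr_nat => /eqP.
have PN : P (\bigcup_n [set w | N i w = n%:R%:E]) = 1%E.
  rewrite measure_bigcup//=.
  rewrite (eq_eseriesr (g := fun n => poisson_prob (rho i) 0 [set n])); last first.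
    by move=> n _; exact: N_law.
  rewrite -(probability_setT (poisson_prob (rho i) 0%N)).
  rewrite [in RHS](_ : [set: nat] = \bigcup_n [set n]); last first.
    by apply/seteqP; split=> n // _; exists n.
  by rewrite measure_bigcup//=; move=> j k _ _ [n [/= -> ->]].
exists (~` \bigcup_n [set w | N i w = n%:R%:E]); split.
- by apply: measurableC; apply: bigcupT_measurable.
- by rewrite probability_setC ?PN ?subee//; apply: bigcupT_measurable.
- by apply: subsetC => w [n _ /= Nn]; exists n.
Qed.

Let expectation_U n : (\int[P]_w (U n w)%:E)%E =
  (\prod_i \sum_(j < n.+1)
     u i ^+ j * fine (poisson_prob (rho i) 0 [set nat_of_ord j]))%:E.
Proof.
rewrite (@integral_prod_sum_indic _ _ _ P 'I_m 'I_n.+1 (fun i j => u i ^+ j)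
  (fun i j => [set w | N i w = (nat_of_ord j)%:R%:E]))//; last first.
  by move=> i j; have /andP[u0 _] := u01 i; exact: exprn_ge0.
rewrite bigA_distr_bigA/= -sumEFin; apply: eq_bigr => f _.
have := @mutually_independent_forall _ _ _ P 'I_m _ (index_enum 'I_m)
  (fun i => [set w | N i w = (nat_of_ord (f i))%:R%:E]) (X_PPP.2 _ _ mA A_disj)
  (index_enum_uniq _) (fun i _ => mN i (f i)).
rewrite (_ : [set w | forall i, i \in index_enum 'I_m -> _] =
    [set w | forall j, N j w = (f j)%:R%:E]); last first.
  apply/seteqP; split=> w Nw j => [|_]; last exact: Nw.
  by apply: Nw; rewrite mem_index_enum.
move=> ->.
rewrite big_split/= EFinM; congr (_ * _)%E.
rewrite -prodEFin; apply: eq_bigr => i _.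
by rewrite N_law fineK// fin_num_measure.
Qed.

(** Where all counts [q i] are finite, [W K] is constant for large [K] and [U n] is constant for
    large [n], with the same value [\prod_i u i ^+ q i]. *)
Let U_cvg : (\int[P]_w (U n w)%:E)%E @[n --> \oo] --> (\int[P]_w (V w)%:E)%E.
Proof.
apply: bounded_convergence => //.
apply: filterS N_fin => w /choice[q Nq].
have -> : V w = \prod_i u i ^+ q i.
  apply: cvg_lim => //; apply: cvg_near_cst.
  have : \forall K \near \oo, forall i, (\sum_(k < K) (X k w \in A i : nat))%N = q i.
    by apply: filter_forall => i; exact: point_count_eventually (Nq i).
  by apply: filterS => K Kq; rewrite WE; apply: eq_bigr => i _; rewrite Kq.
apply: cvg_near_cst; exists (\max_i q i)%N => // n /= qn.
apply: eq_bigr => i _; apply: U_fin => //.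
by apply: leq_trans qn; exact: leq_bigmax.
Qed.

(** The expectation of [V] is reached in two ways: as the limit of those of [W K], and as the limit
    of those of [U n]. The latter are products of truncated generating functions, and
    [1 - u i = c i] gives the exponent. *)
Lemma PPP_laplace_simple :
  (\int[P]_w (\prod_(k < K) (1 - \sum_i c i * \1_(A i) (X k w)))%:E)%E @[K --> \oo]
  --> (expR (- (lambda * \sum_i c i * fine (plane_measure (A i)))))%:E.
Proof.
have WV : (\int[P]_w (W K w)%:E)%E @[K --> \oo] --> (\int[P]_w (V w)%:E)%E.
  by apply: bounded_convergence => //; apply: aeW => w; exact: W_cvg.
suff <- : (\int[P]_w (V w)%:E)%E =
  (expR (- (lambda * \sum_i c i * fine (plane_measure (A i)))))%:E by [].
have := U_cvg; under eq_fun do rewrite expectation_U.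
move=> /cvg_unique; apply; first exact: ereal_hausdorff.
apply: cvg_EFin; first exact: nearW.
rewrite mulr_sumr -sumrN expR_sum.
apply: cvg_prodr => i.
have := @poisson_generating_function R (rho i) (u i) 0%N (rho_ge0 i).
rewrite (_ : rho i * _ = lambda * (c i * fine (plane_measure (A i))))//.
by rewrite /rho /u; ring.
Qed.

End laplace_simple.

Section disjoint_sum.
Import HBNNSimple.

(** Level sets of the nonzero values. The value 0 is left out because its level set may have
    infinite area, whereas count laws are given on sets of finite area. That each [c i] is attained
    lets bounds on [f] pass to the coefficients. *)
Lemma nnsfun_disjoint_sum (d : measure_display) (T : measurableType d)
    (R : realType) (f : {nnsfun T >-> R}) :
  exists (m : nat) (c : 'I_m -> R) (A : 'I_m -> set T),
    [/\ forall i, measurable (A i), trivIset [set: 'I_m] A,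
        forall i, 0 < c i /\ exists x, f x = c i &
        forall x, f x = \sum_i c i * \1_(A i) x].
Proof.
pose r := [seq y <- fset_set (range f) | y != 0].
have ur : uniq r by apply: filter_uniq; exact: fset_uniq.
have rP y : (y \in r) = (y != 0) && (y \in range f).
  by rewrite mem_filter in_fset_set//; exact: fimfunP.
pose c (i : 'I_(size r)) := r`_i.
have cr i : c i \in r by apply: mem_nth.
exists (size r), c, (fun i => f @^-1` [set c i]); split.
- by move=> i; exact: measurable_funPTI.
- move=> i j _ _ [x [/= -> cij]]; apply: val_inj => /=.
  by apply/eqP; rewrite -(nth_uniq 0 _ _ ur)//; apply/eqP.
- move=> i; have := cr i; rewrite rP => /andP[c0 /set_mem[x _ fx]].
  by split; [rewrite lt_neqAle eq_sym c0/= -fx; exact: fun_ge0|exists x].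
move=> x; have [f0|f0] := eqVneq (f x) 0.
  rewrite f0 big1// => i _; rewrite indicE memNset ?mulr0//= => fc.
  by have := cr i; rewrite rP -fc f0 eqxx.
have fr : f x \in r by rewrite rP f0; apply/mem_set; exists x.
have fxr : (index (f x) r < size r)%N by rewrite index_mem.
rewrite (bigD1 (Ordinal fxr))//= /c/= nth_index// indicE mem_set//= ?nth_index//.
rewrite mulr1 big1 ?addr0// => i /eqP ni.
rewrite indicE memNset ?mulr0//= => fxi; apply: ni; apply: val_inj => /=.
by rewrite fxi index_uniq.
Qed.

End disjoint_sum.

(** * Laplace functional on integrable functions with values in [0, 1] *)

Section laplace.
Import HBNNSimple.
Context {d : measure_display} {Omega : measurableType d} {R : realType}.
Variables (P : probability Omega R) (X : nat -> {RV P >-> (R * R)%type}).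
Variable lambda : R.
Hypothesis lambda_ge0 : 0 <= lambda.
Hypothesis X_PPP : homogeneous_PPP P lambda X.

Let W (q : R * R -> R) (K : nat) := (\int[P]_w (\prod_(k < K) (1 - q (X k w)))%:E)%E.

Let mW (q : R * R -> R) K : measurable_fun [set: R * R] q ->
  measurable_fun [set: Omega] (fun w => \prod_(k < K) (1 - q (X k w))).
Proof.
move=> mq; apply: measurable_prod => k _; apply: measurable_funB => //.
exact: measurableT_comp.
Qed.

Let W_le (q q' : R * R -> R) K :
  measurable_fun [set: R * R] q -> measurable_fun [set: R * R] q' ->
  (forall x, q x <= q' x <= 1) -> (W q' K <= W q K)%E.
Proof.
move=> mq mq' qq'; apply: ge0_le_integral => //.
- move=> w _; rewrite lee_fin prodr_ge0// => k _; rewrite subr_ge0.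
  by have /andP[] := qq' (X k w).
- by apply/measurable_EFinP; exact: mW.
- by apply/measurable_EFinP; exact: mW.
- move=> w _; rewrite lee_fin; apply: ler_prod => k _.
  by have /andP[? ?] := qq' (X k w); rewrite subr_ge0 lerB// andbT.
Qed.

Let W_anti (q : R * R -> R) K K' :
  measurable_fun [set: R * R] q -> (forall x, 0 <= q x <= 1) -> (K <= K')%N ->
  (W q K' <= W q K)%E.
Proof.
move=> mq q01 KK'.
have p0 w n : 0 <= \prod_(k < n) (1 - q (X k w)).
  by rewrite prodr_ge0// => k _; rewrite subr_ge0; have /andP[] := q01 (X k w).
apply: ge0_le_integral => //.
- by move=> w _; rewrite lee_fin.
- by apply/measurable_EFinP; exact: mW.
- by apply/measurable_EFinP; exact: mW.
move=> w _; rewrite lee_fin -(subnKC KK').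
elim: (K' - K)%N => [|n ih]; first by rewrite addn0.
rewrite addnS big_ord_recr/=; apply: le_trans ih.
apply: ler_piMr; first exact: p0.
by rewrite lerBlDr lerDl; have /andP[] := q01 (X (K + n)%N w).
Qed.

Let W_nnsfun (f : {nnsfun (R * R)%type >-> R}) : (forall x, f x <= 1) ->
  (\int[@plane_measure R]_x (f x)%:E < +oo)%E ->
  W f K @[K --> \oo] -->
    (expR (- (lambda * fine (\int[@plane_measure R]_x (f x)%:E))))%:E.
Proof.
move=> f1; have [m [c [A [mA dA c_range fE]]]] := @nnsfun_disjoint_sum _ _ _ f.
have intf : (\int[@plane_measure R]_x (f x)%:E = \sum_i (c i)%:E * plane_measure (A i))%E.
  under eq_integral do rewrite fE -sumEFin.
  rewrite ge0_integral_sum//.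
  - apply: eq_bigr => i _; under eq_integral do rewrite EFinM.
    rewrite ge0_integralZl//= ?integral_indic ?setIT//.
    + by apply/measurable_EFinP; exact: measurable_indic.
    + by rewrite lee_fin ltW//; have [] := c_range i.
  - move=> i; apply/measurable_EFinP; apply: measurable_funM => //.
  - by move=> i x _; rewrite lee_fin mulr_ge0// ltW//; have [] := c_range i.
rewrite intf => fin_sum.
have A_fin i : (plane_measure (A i) < +oo)%E.
  have [c0 _] := c_range i.
  (* A positive multiple of this area is a single term of the finite integral of [f]. *)
  rewrite -(@lte_pmul2l _ (c i)%:E)//.
  rewrite gt0_muley ?lte_fin//; apply: le_lt_trans fin_sum.
  rewrite (bigD1 i)//= leeDl// sume_ge0// => j _.
  by rewrite mule_ge0// lee_fin ltW//; have [] := c_range j.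
have -> : fine (\sum_i (c i)%:E * plane_measure (A i))%E =
    \sum_i c i * fine (plane_measure (A i)).
  rewrite (eq_bigr (fun i => (c i * fine (plane_measure (A i)))%:E)) ?sumEFin//.
  by move=> i _; rewrite EFinM fineK// ge0_fin_numE.
have c01 i : 0 <= c i <= 1.
  by have [c0 [x <-]] := c_range i; rewrite f1 andbT.
have := @PPP_laplace_simple _ _ _ P X _ lambda_ge0 X_PPP _ _ _ mA A_fin dA c01.
by under [X in X @ _]eq_fun do (under eq_integral do under eq_bigr do rewrite -fE).
Qed.

(** Approximation from below by simple [s n], with limits in [n] and in [K] exchanged by
    monotonicity. Since [W] decreases in its function, the limit of [W q] is at most every [e n].
    Since [W] decreases in [K], [e n] is at most [W (s n) K], and letting [n] grow at fixed [K]
    bounds [W q K] from below. *)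
Lemma PPP_laplace (q : R * R -> R) :
  measurable_fun [set: R * R] q -> (forall x, 0 <= q x <= 1) ->
  (\int[@plane_measure R]_x (q x)%:E < +oo)%E ->
  (\int[P]_w (\prod_(k < K) (1 - q (X k w)))%:E)%E @[K --> \oo] -->
    (expR (- (lambda * fine (\int[@plane_measure R]_x (q x)%:E))))%:E.
Proof.
move=> mq q01 q_int; rewrite -/(W q _).
have mEq : measurable_fun [set: R * R] (EFin \o q) by exact/measurable_EFinP.
pose s := nnsfun_approx measurableT mEq.
have s_cvg x : s n x @[n --> \oo] --> q x.
  have q0 y : [set: R * R] y -> (0 <= (EFin \o q) y)%E.
    by rewrite lee_fin; have /andP[] := q01 y.
  by have /fine_cvg := cvg_nnsfun_approx measurableT mEq q0 (I : [set: R * R] x).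
have s_nd n n' x : (n <= n')%N -> s n x <= s n' x.
  by move=> nn'; have /lefP := nd_nnsfun_approx measurableT mEq nn'; exact.
have s_le n x : s n x <= q x.
  rewrite -(cvg_lim _ (s_cvg x))//; apply: nondecreasing_cvgn_le.
    by move=> a b ab; exact: s_nd.
  by apply/cvg_ex; exists (q x).
have s1 n x : s n x <= 1 by apply: le_trans (s_le n x) _; have /andP[] := q01 x.
have ms n : measurable_fun [set: R * R] (s n) by exact: measurable_funPT.
pose I n := (\int[@plane_measure R]_x (s n x)%:E)%E.
have I_le n : (I n <= \int[@plane_measure R]_x (q x)%:E)%E.
  apply: ge0_le_integral => //.
  - by move=> x _; rewrite lee_fin.
  - exact/measurable_EFinP.
  - by move=> x _; rewrite lee_fin.
have I_fin n : (I n < +oo)%E by exact: le_lt_trans (I_le n) q_int.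
pose e n := expR (- (lambda * fine (I n))).
have Wse n : W (s n) K @[K --> \oo] --> (e n)%:E.
  exact: (W_nnsfun (s n) (s1 n) (I_fin n)).
have e_cvg : (e n)%:E @[n --> \oo] -->
    (expR (- (lambda * fine (\int[@plane_measure R]_x (q x)%:E))))%:E.
  apply: cvg_EFin; first exact: nearW.
  apply: continuous_cvg; first exact: continuous_expR.
  apply: cvgN; apply: cvgM; first exact: cvg_cst.
  apply: fine_cvg; rewrite fineK; last first.
    rewrite ge0_fin_numE// integral_ge0// => x _.
    by rewrite lee_fin; have /andP[] := q01 x.
  rewrite (_ : (\int[_]_x (q x)%:E)%E =
      (\int[@plane_measure R]_x (limn (fun n => (s n x)%:E)))%E); last first.
    apply: eq_integral => x _; apply/esym/cvg_lim => //.
    by apply: cvg_EFin; [exact: nearW|exact: s_cvg].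
  apply: cvg_monotone_convergence => //.
  - by move=> n; exact/measurable_EFinP.
  - by move=> n x _; rewrite lee_fin.
  - by move=> x _ n n' nn'; rewrite lee_fin; exact: s_nd.
have Wq_cvg : cvgn (W q).
  apply: ereal_nonincreasing_is_cvgn => K K' KK'; exact: W_anti.
have Wq_ge K :
    ((expR (- (lambda * fine (\int[@plane_measure R]_x (q x)%:E))))%:E <= W q K)%E.
  have e_le n : ((e n)%:E <= W (s n) K)%E.
    apply: (cvge_to_le (Wse n)); exists K => // K' /= KK'.
    by apply: W_anti => // x; rewrite s1 andbT.
  have WsWq : W (s n) K @[n --> \oo] --> W q K.
    apply: bounded_convergence.
    - by move=> n; exact: mW.
    - exact: mW.
    - move=> n w; rewrite prodr_ge0 ?prodr_ile1// => k _; rewrite ?subr_ge0 ?s1//.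
      by rewrite lerBlDr lerDl; exact: fun_ge0.
    - apply: aeW => w; apply: cvg_prodr => k.
      by apply: cvgB; [exact: cvg_cst|exact: s_cvg].
  by apply: (lee_cvg_to e_cvg WsWq); exact: nearW.
have Wq_le n : (limn (W q) <= (e n)%:E)%E.
  apply: (lee_cvg_to Wq_cvg (Wse n)); apply: nearW => K.
  by apply: W_le => // x; rewrite s_le; have /andP[] := q01 x.
rewrite (_ : (expR _)%:E = limn (W q)); first exact: Wq_cvg.
apply/eqP; rewrite eq_le; apply/andP; split.
  by apply: lime_ge => //; exact: nearW.
by apply: (cvge_to_ge e_cvg); exact: nearW.
Qed.

End laplace.

(** * Outage probability *)

Lemma probability_ae_eq (d : measure_display) (Omega : measurableType d) (R : realType)
    (P : probability Omega R) (A B : set Omega) :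
  measurable A -> measurable B -> {ae P, forall w, A w <-> B w} -> P A = P B.
Proof.
move=> mA mB AB.
rewrite -[X in P X = _]setIT -[X in _ = P X]setIT -!integral_indic//.
apply: ae_eq_integral => //; try exact/measurable_EFinP/measurable_indic.
apply: filterS AB => w AB _; rewrite !indicE; congr (_%:R%:E).
by congr nat_of_bool; apply/idP/idP; rewrite !inE => /AB.
Qed.

Lemma measurable_invr (R : realType) : measurable_fun [set: R] (@GRing.inv R).
Proof.
(* Squaring makes the base nonnegative, where the power [-1] is the inverse; at 0 both sides are
   0. *)
rewrite (_ : GRing.inv = fun x : R => x * (x ^+ 2) `^ (-1)).
  apply: measurable_funM => //; apply: (measurableT_comp (measurable_powR _)).
  exact: measurable_funX.
apply/funext => x; rewrite powR_inv1 ?sqr_ge0//.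
have [->|x0] := eqVneq x 0; first by rewrite invr0 mul0r.
by field.
Qed.

(** * Availability of a single station *)

Section availability.
Context {R : realType}.
Variables (lambdaMT kappa alpha PRx mu sigma : R).
Hypotheses (lambdaMT_gt0 : 0 < lambdaMT) (kappa_gt0 : 0 < kappa).
Hypotheses (alpha_gt0 : 0 < alpha) (PRx_gt0 : 0 < PRx).

Local Notation gA := (gA lambdaMT kappa alpha PRx mu sigma).
Local Notation pcov := (pcov lambdaMT kappa alpha PRx mu sigma).
Local Notation tp := (transmit_power kappa alpha PRx).
Local Notation available := (available lambdaMT kappa alpha PRx mu sigma).

Definition unavailable (l : nat) : set ((R * R) * R) :=
  [set xc | ~ available xc.1 xc.2 l].

Lemma measurable_unavailable l : measurable (unavailable l).
Proof.
apply: measurableC; rewrite -[X in measurable X]setTI.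
have mtp : measurable_fun [set: (R * R) * R] (fun xc => tp xc.1 xc.2).
  apply: measurable_funM.
    apply: measurable_funM => //; apply: (measurableT_comp (measurable_powR alpha)).
    exact: (measurableT_comp measurable_distance0).
  exact: (measurableT_comp (@measurable_invr R)).
apply: measurable_fun_le => //.
apply: measurable_funD => //; apply: measurable_funM => //.
exact: (measurableT_comp (measurable_powR _)).
Qed.

(** Dividing [10 * (ln c / ln 10)] by [zeta] gives [ln c], so the exponential in [covered] returns
    [c]; the rest is [gA_le_pcov] and clearing the positive denominator. *)
Lemma available_covered (x : R * R) (c : R) (l : nat) : 0 < c ->
  available x c l <->
  xsection (covered (PRx * kappa) alpha zeta (pcov l)) x (10 * (ln c / ln 10)).
Proof.
move=> c0; rewrite /xsection/= inE /covered/= /available.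
have ln10 : ln 10 != 0 :> R by rewrite gt_eqF// ln_gt0// ltr1n.
rewrite (_ : _ / zeta = ln c); last by rewrite /zeta; field; rewrite ln10.
have t0 : 0 <= tp x c.
  by rewrite /tp divr_ge0 ?mulr_ge0 ?powR_ge0//; exact: ltW.
by rewrite gA_le_pcov// lnK ?posrE// /tp ler_pdivrMr.
Qed.

(** The probability that a station at [x] holding [l] power units is available. *)
Definition coverage (l : nat) (x : R * R) : R :=
  fine (normal_prob mu sigma (xsection (covered (PRx * kappa) alpha zeta (pcov l)) x)).

Lemma coverage01 l x : 0 <= coverage l x <= 1.
Proof.
rewrite /coverage fine_ge0//= -lee_fin fineK ?fin_num_measure//.
  by apply: probability_le1; apply: measurable_xsection; exact: measurable_covered.
by apply: measurable_xsection; exact: measurable_covered.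
Qed.

Lemma measurable_coverage l : measurable_fun [set: R * R] (coverage l).
Proof.
apply: measurableT_comp => //; apply: measurable_fun_xsection.
exact: measurable_covered.
Qed.

Lemma coverageE l x : (coverage l x)%:E =
  normal_prob mu sigma (xsection (covered (PRx * kappa) alpha zeta (pcov l)) x).
Proof.
rewrite fineK// fin_num_measure//; apply: measurable_xsection.
exact: measurable_covered.
Qed.

Lemma integral_coverage l : sigma != 0 ->
  (\int[@plane_measure R]_x (coverage l x)%:E)%E =
  (Upsilon kappa alpha PRx mu sigma * pcov l `^ (2 / alpha))%:E.
Proof.
move=> s0; under eq_integral do rewrite coverageE.
rewrite integral_covered//; last 2 first.
- exact: mulr_gt0.
- exact: pcov_ge0.
have c0 : 0 <= 1 / (PRx * kappa) by rewrite divr_ge0// mulr_ge0// ltW.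
rewrite (_ : pcov l / _ = pcov l * (1 / (PRx * kappa))); last by rewrite mul1r.
by rewrite powRM ?pcov_ge0// /Upsilon; congr _%:E; ring.
Qed.

(** The shadowing is positive only almost surely, so availability and the event on its decibel value
    are compared up to a null set. *)
Lemma probability_unavailable (d : measure_display) (Omega : measurableType d)
    (P : probability Omega R) (Y : {RV P >-> R}) l x :
  log_normal_dB P mu sigma Y ->
  P (Y @^-1` xsection (unavailable l) x) = (1 - coverage l x)%:E.
Proof.
move=> [Y_gt0 Y_law].
pose D := ~` xsection (unavailable l) x.
have mU : measurable (xsection (unavailable l) x).
  by apply: measurable_xsection; exact: measurable_unavailable.
have mD : measurable D by exact: measurableC.
rewrite -[xsection _ _]setCK -/D preimage_setC probability_setC ?EFinB; last first.
  exact: (measurable_funPTI Y mD).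
congr (_ - _)%E; rewrite coverageE -Y_law; last first.
  by apply: measurable_xsection; exact: measurable_covered.
have mB : measurable (xsection (covered (PRx * kappa) alpha zeta (pcov l)) x).
  by apply: measurable_xsection; exact: measurable_covered.
apply: probability_ae_eq.
- exact: (measurable_funPTI Y mD).
- have mf : measurable_fun [set: Omega] (fun w => 10 * (ln (Y w) / ln 10)).
    apply: measurable_funM => //; apply: measurable_funM => //.
    by apply: measurableT_comp => //; exact: measurable_ln.
  by have := mf measurableT _ mB; rewrite setTI.
apply: filterS Y_gt0 => w Yw0; have [ac ca] := @available_covered x _ l Yw0.
split=> [nU|cv].
  by apply: ac; apply: contrapT => na; apply: nU; rewrite /xsection/= inE.
by rewrite /D /xsection/= inE /unavailable/= => /(_ (ca cv)).
Qed.

End availability.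

Theorem proposition1 (R : realType)
    (lambdaB lambdaMT kappa alpha PRx mu sigma : R) (L : nat)
    (lambdaB_gt0 : 0 < lambdaB) (lambdaMT_gt0 : 0 < lambdaMT)
    (kappa_gt0 : 0 < kappa) (alpha_gt0 : 0 < alpha) (PRx_gt0 : 0 < PRx)
    (sigma_gt0 : 0 < sigma) (L_ge1 : (1 <= L)%N)
    (v : 'I_L.+1 -> R)
    (v_ge0 : forall l, 0 <= v l) (v_sum1 : \sum_(l < L.+1) v l = 1)
    (d : measure_display) (Omega : measurableType d) (P : probability Omega R)
    (X : nat -> {RV P >-> (R * R)%type})
    (chi : nat -> {RV P >-> R})
    (b : nat -> {RV P >-> nat})
    (X_PPP : homogeneous_PPP P lambdaB X)
    (chi_law : forall k, log_normal_dB P mu sigma (chi k))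
    (chi_indep : mutually_independent P (fun k => sigma_rv (chi k)))
    (chi_indep_X : independent_systems P (sigma_seq chi) (sigma_seq X))
    (b_le_L : forall k w, (b k w <= L)%N)
    (b_law : forall k (l : 'I_L.+1), P [set w | b k w = l] = (v l)%:E)
    (b_indep : mutually_independent P (fun k => sigma_rv (b k)))
    (b_indep_X_chi : independent_systems P (sigma_seq b)
                       <<s sigma_seq X `|` sigma_seq chi >>) :
  P (outage lambdaMT kappa alpha PRx mu sigma X chi b) =
  (expR (- LambdaBA lambdaB lambdaMT kappa alpha PRx mu sigma v
             (pcov lambdaMT kappa alpha PRx mu sigma L)))%:E.
Proof.
pose cov l := coverage lambdaMT kappa alpha PRx mu sigma l.
have cov01 l x : 0 <= cov l x <= 1 by exact: coverage01.
have mcov l : measurable_fun [set: R * R] (cov l) by exact: measurable_coverage.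
have s0 : sigma != 0 by rewrite gt_eqF.
pose q x := \sum_(l < L.+1) v l * cov l x.
have mq : measurable_fun [set: R * R] q.
  by apply: measurable_sum => l; exact: measurable_funM.
have q01 x : 0 <= q x <= 1.
  rewrite sumr_ge0 => [/=|l _]; last by rewrite mulr_ge0//; have /andP[] := cov01 l x.
  rewrite -v_sum1; apply: ler_sum => l _.
  by rewrite ler_piMr//; have /andP[] := cov01 l x.
(* As the [v l] sum to 1, [1 - q] is the mixture of unavailabilities that [independent_mixture]
   produces. *)
have qE x : 1 - q x = \sum_(l < L.+1) v l * (1 - cov l x).
  by rewrite -[X in X - q x]v_sum1 -sumrB; apply: eq_bigr => l _; rewrite mulrBr mulr1.
have int_q : (\int[@plane_measure R]_x (q x)%:E)%E =
    (\sum_(l < L.+1) v l * (Upsilon kappa alpha PRx mu sigma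
      * pcov lambdaMT kappa alpha PRx mu sigma l `^ (2 / alpha)))%:E.
  under eq_integral do rewrite -sumEFin.
  rewrite ge0_integral_sum//; last 2 first.
  - by move=> l; apply/measurable_EFinP; exact: measurable_funM.
  - by move=> l x _; rewrite lee_fin mulr_ge0//; have /andP[] := cov01 l x.
  rewrite -sumEFin; apply: eq_bigr => l _.
  under eq_integral do rewrite EFinM.
  rewrite ge0_integralZl//=; last 3 first.
  - exact/measurable_EFinP.
  - by move=> x _; rewrite lee_fin; have /andP[] := cov01 l x.
  - by rewrite lee_fin.
  by rewrite integral_coverage.
pose C l := unavailable lambdaMT kappa alpha PRx mu sigma l.
pose O K := [set w | forall k : 'I_K, C (b k w) (X k w, chi k w)].
have X_indep_chi : independent_systems P (sigma_seq X) (sigma_seq chi).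
  by move=> A B mA mB; rewrite setIC muleC; exact: chi_indep_X.
have mC l : measurable (C l) by exact: measurable_unavailable.
have PO K : P (O K) = (\int[P]_w (\prod_(k < K) (1 - q (X k w)))%:E)%E.
  rewrite /O (@independent_mixture _ _ _ _ _ _ _ P X chi L v b X_indep_chi chi_indep
    b_le_L b_law b_indep b_indep_X_chi C (fun l x => 1 - cov l x) mC).
  - by apply: eq_integral => w _; congr _%:E; apply: eq_bigr => k _; rewrite qE.
  - by move=> l; exact: measurable_funB.
  - by move=> k l x; exact: probability_unavailable.
have mO K : measurable (O K).
  apply: measurable_forall_fin => k.
  have -> : (fun w => C (b k w) (X k w, chi k w)) =
      \bigcup_l ([set w | b k w = l] `&` [set w | C l (X k w, chi k w)]).
    by apply/seteqP; split=> [w Cw|w [l _ [/= <-]]//]; exists (b k w).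
  apply: bigcupT_measurable => l; apply: measurableI.
    by rewrite -[X in measurable X]/(b k @^-1` [set l]); apply: measurable_funPTI.
  have mXY : measurable_fun [set: Omega] (fun w => (X k w, chi k w)).
    exact: measurable_fun_pair.
  by have := mXY measurableT _ (mC l); rewrite setTI.
have outE : outage lambdaMT kappa alpha PRx mu sigma X chi b = \bigcap_K O K.
  apply/seteqP; split=> w; first by move=> /forallNP nA K _ k; exact: nA.
  (* Station [k] is among the first [k.+1]. *)
  by move=> Ow [k Ak]; apply: (Ow k.+1 I (Ordinal (ltnSn k))).
have P_out : P (O K) @[K --> \oo] -->
    P (outage lambdaMT kappa alpha PRx mu sigma X chi b).
  rewrite outE; apply: nonincreasing_cvg_mu => //.
  - by rewrite (le_lt_trans (probability_le1 P (mO 0%N)))// ltry.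
  - exact: bigcapT_measurable.
  - move=> K K' KK'; apply/subsetPset => w Ow k.
    exact: Ow (widen_ord KK' k).
have := @PPP_laplace _ _ _ P X _ (ltW lambdaB_gt0) X_PPP _ mq q01.
rewrite int_q => /(_ (ltry _)).
under eq_fun do rewrite -PO.
(* The sequence [P (O K)] tends to the outage probability by continuity from above and to the
   exponential by the Laplace functional; the two limits coincide. *)
move=> /(cvg_unique _ P_out) ->//.
congr (expR (- _))%:E.
rewrite LambdaBA_pcov// mulr_sumr; apply: eq_bigr => l _.
by rewrite /LambdaB; ring.
Qed.
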